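(* Let $A$ be a positive definite Hermitian operator on $V$ with smallest and largest eigenvalues $\lambda_1<\lambda_N$, let $z\in\mathbb C$ with $\arg z\in(-\pi,\pi)$, let $\mu_z\in\mathbb R$ with $\mu_z>-\lambda_1$ and $z\ne\mu_z$, put $\widetilde z:=(z-\mu_z)^{-1}$, $B_z:=(\mu_zI+A)^{-1}$, and assume $\phi:=\arg\widetilde z\in(-\pi,\pi)$. Let $w$ be the solution of $\widetilde zw+B_zw=\widetilde zB_zg$ and let $w_n$ be the $n$th iterate of the CG method applied to this equation. Then, with the norm $|||v|||^2:=|\widetilde z|\,\|v\|^2+(B_zv,v)$, the error $e_n:=w_n-w$ satisfies $$|||e_n|||\le\sec(\tfrac12\phi)\,|T_n(\widetilde s_z)|^{-1}\,|||e_0|||,\quad\text{with } T_n(\widetilde s_z)=\tfrac12(\widetilde\eta_z^n+\widetilde\eta_z^{-n}),$$ where $$\widetilde\eta_z:=-\frac{\sqrt{\widetilde\lambda_N+\widetilde z}-\sqrt{\widetilde\lambda_1+\widetilde z}}{\sqrt{\widetilde\lambda_N+\widetilde z}+\sqrt{\widetilde\lambda_1+\widetilde z}}\quad\text{and}\quad|\widetilde\eta_z|\le c(z,\lambda_1,\mu_z)<1,$$ the constant $c(z,\lambda_1,\mu_z)$ being independent of $\lambda_N$.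
   Context: $V$ is a finite-dimensional complex inner product space with inner product $(\cdot,\cdot)$ and norm $\|\cdot\|$. The equation $\widetilde zw+B_zw=\widetilde zB_zg$ is equivalent to $(zI+A)w=g$. Given $g,w_0\in V$, the CG method is defined by: $r_0:=\widetilde zB_zg-(\widetilde zI+B_z)w_0$; $V_0:=\{0\}$, $V_n:=\operatorname{span}\{r_0,B_zr_0,\dots,B_z^{n-1}r_0\}$ for $n\ge1$; $w_n=w_0+v_n$ with $v_n\in V_n$ is the unique such element with $((\widetilde zI+B_z)w_n,\varphi)=(\widetilde zB_zg,\varphi)$ for all $\varphi\in V_n$. Further, $\widetilde\lambda_1:=(\mu_z+\lambda_N)^{-1}$ and $\widetilde\lambda_N:=(\mu_z+\lambda_1)^{-1}$ are the extremal eigenvalues of $B_z$, and $\widetilde s_z:=-\frac{\widetilde\lambda_1+\widetilde\lambda_N+2\widetilde z}{\widetilde\lambda_N-\widetilde\lambda_1}$. Square roots are chosen with argument in $(-\tfrac12\pi,\tfrac12\pi)$. $T_n$ is the Tchebyshev polynomial of degree $n$, defined by $T_n(\cos\theta)=\cos(n\theta)$ for $\theta\in\mathbb C$. *)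

(* Defs.v *)
From HB Require Import structures.
From mathcomp Require Import all_boot all_order all_algebra.
From mathcomp Require Import boolp classical_sets reals sequences exp trigo.
From mathcomp Require Import complex.

Set Implicit Arguments.
Unset Strict Implicit.
Unset Printing Implicit Defensive.

Import Order.TTheory GRing.Theory Num.Theory.
Local Open Scope ring_scope.
Local Open Scope complex_scope.

Section ComplexFunctions.
Variable R : realType.
Implicit Types z : R[i].

(* Principal argument, in ]-pi, pi], with the convention carg 0 = 0. *)
Definition carg z : R :=
  if z == 0 then 0
  else let t := acos (complex.Re z / Normc.normc z) in
       if 0 <= complex.Im z then t else - t.

Definition cexp z : R[i] :=
  (expR (complex.Re z))%:C * (cos (complex.Im z) +i* sin (complex.Im z)).

Definition ccos z : R[i] := (cexp ('i * z) + cexp (- ('i * z))) / 2%:R.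

Definition is_tchebyshev (n : nat) (p : {poly R[i]}) : Prop :=
  size p = n.+1 /\ forall theta : R[i], p.[ccos theta] = ccos (n%:R * theta).

(* The conditions of is_tchebyshev determine the polynomial uniquely. *)
Definition tchebyshev (n : nat) : {poly R[i]} :=
  xget 0 [set p | is_tchebyshev n p]%classic.

End ComplexFunctions.

Section Operators.
Variables (R : realType) (V : vectType R[i]) (dot : {dot V for Num.conj}).
Implicit Types (A B : 'End(V)) (l : R) (zt : R[i]) (v : V).

Definition hermitian_op A : Prop := forall u v, dot (A u) v = dot u (A v).

Definition posdef_op A : Prop := forall v, v != 0 -> 0 < dot (A v) v.

(* In R[i], comparable to a real means real: the two definitions below also say
   that all eigenvalues are real, which is automatic for Hermitian operators. *)
Definition smallest_eigenvalue A l : Prop :=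
  passmx.leigenvalue A l%:C /\ forall a : R[i], passmx.leigenvalue A a -> l%:C <= a.

Definition largest_eigenvalue A l : Prop :=
  passmx.leigenvalue A l%:C /\ forall a : R[i], passmx.leigenvalue A a -> a <= l%:C.

(* The radicand is a nonnegative real when B is positive semidefinite; on such
   elements of R[i], sqrtC is the nonnegative square root. *)
Definition tnorm B zt v : R[i] := sqrtC (`|zt| * dot v v + dot (B v) v).

Definition krylov B (r : V) (n : nat) : {vspace V} :=
  <<[seq iter k B r | k <- iota 0 n]>>%VS.

Section CG.
Variables (B : 'End(V)) (zt : R[i]) (g w0 : V).

Definition cg_residual : V := zt *: B g - (zt *: w0 + B w0).

Definition is_cg_iterate (n : nat) (w : V) : Prop :=
  w - w0 \in krylov B cg_residual n /\
  forall phi, phi \in krylov B cg_residual n ->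
    dot (zt *: w + B w) phi = dot (zt *: B g) phi.

(* For B positive definite and zt off ]-oo, 0], the Galerkin problem has exactly
   one solution, so that the default value w0 is irrelevant. *)
Definition cg_iterate (n : nat) : V := xget w0 [set w | is_cg_iterate n w]%classic.

End CG.
End Operators.

(* Main.v *)
Require Import Defs.
From HB Require Import structures.
From mathcomp Require Import all_boot all_order all_algebra.
From mathcomp Require Import boolp classical_sets reals sequences exp trigo.
From mathcomp Require Import complex.
From mathcomp Require Import ring lra.

Set Implicit Arguments.
Unset Strict Implicit.
Unset Printing Implicit Defensive.

Import Order.TTheory GRing.Theory Num.Theory.
Local Open Scope ring_scope.
Local Open Scope complex_scope.

(** The operator zt + B of the Galerkin problem is bounded by 1 in the energy
    norm |||v|||^2 = |zt| (v, v) + (B v, v), by Cauchy's inequality, and coercive with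
    constant cos (phi / 2), phi = arg zt: after multiplication by the unit number
    of argument - phi / 2, the two terms of ((zt + B) v, v) make the angles
    phi / 2 and - phi / 2 with the positive axis ([coercive]).  Hence the Galerkin
    error e_n is, up to the factor sec (phi / 2), at most any vector of
    e_0 + K_n, K_n being the Krylov space ([galerkin_quasi_optimal]).

    Since (zt + B) e_0 is minus the initial residual, e_0 + K_n contains q(B) e_0
    for each polynomial q of degree at most n with q(- zt) = 1
    ([krylov_error]).  Hermitian operators have orthogonal decompositions into
    eigenvectors ([hermitian_decomposition]), so |||q(B) e_0||| is at most
    |||e_0||| times the maximum of |q| on the spectrum of B ([tnorm_pact]).  The
    spectrum lies between lt1 and ltN; the choice q = T_n(s(x)) / T_n(s(- zt)),
    with s affine from that interval onto [-1, 1], gives the bound, because T_n is at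
    most 1 in modulus on [-1, 1] and s(- zt) = st.

    With a = sqN and b = sq1, st = (eta + 1/eta) / 2 since
    eta + 1/eta = - 2 (a^2 + b^2) / (a^2 - b^2), and E = eta in
    T_n((E + 1/E) / 2) = (E^n + E^-n) / 2 is allowed because the complex
    exponential reaches every nonzero number ([tchebyshev_eval]).  Finally
    |eta|^2 = (S - 2 P) / (S + 2 P), where S = |a|^2 + |b|^2 and P is the
    real part of a times the conjugate of b.  The imaginary parts of a and b have
    the same sign and their real parts are at least that of the square root of zt,
    so P >= (|zt| + Re zt) / 2, while S <= 2 (ltN + |zt|); neither bound involves
    lN ([normc_sqrtc_ratio]). *)

(** * Polynomials in an endomorphism *)

Section PolynomialAction.
Variables (K : fieldType) (V : vectType K) (f : 'End(V)).
Implicit Types (p q : {poly K}) (u v : V) (a b : K).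

(** The vector p(f) v; defined vector by vector, so that no ring structure on
    the endomorphisms of a possibly trivial space is needed. *)
Definition pact p v : V := \sum_(i < size p) p`_i *: iter i f v.

Lemma pact_widen n p v :
  (size p <= n)%N -> pact p v = \sum_(i < n) p`_i *: iter i f v.
Proof.
move=> pn; rewrite /pact (big_ord_widen n (fun i => p`_i *: iter i f v)) //.
rewrite big_mkcond /=; apply: eq_bigr => i _; case: ltnP => // pi.
by rewrite nth_default ?scale0r.
Qed.

Lemma pactZ a p v : pact (a *: p) v = a *: pact p v.
Proof.
rewrite (pact_widen _ (size_scale_leq a p)) /pact scaler_sumr.
by apply: eq_bigr => i _; rewrite coefZ scalerA.
Qed.

Lemma pactD p q v : pact (p + q) v = pact p v + pact q v.
Proof.
pose n := maxn (size p) (size q).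
rewrite (pact_widen (n := n) _ (size_polyD _ _)).
rewrite (pact_widen (n := n) _ (leq_maxl _ _)).
rewrite (pact_widen (n := n) _ (leq_maxr _ _)) -big_split /=.
by apply: eq_bigr => i _; rewrite coefD scalerDl.
Qed.

Lemma pact1 v : pact 1 v = v.
Proof. by rewrite /pact size_poly1 big_ord1 coef1 scale1r. Qed.

Lemma pactMX p v : pact (p * 'X) v = pact p (f v).
Proof.
have sz : (size (p * 'X)%R <= (size p).+1)%N.
  by rewrite (leq_trans (size_polyMleq _ _)) // size_polyX addn2.
rewrite (pact_widen _ sz) big_ord_recl coefMX eqxx scale0r add0r /pact.
by apply: eq_bigr => i _; rewrite coefMX lift0 iterSr.
Qed.

Lemma pactZr a p v : pact p (a *: v) = a *: pact p v.
Proof.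
rewrite /pact scaler_sumr; apply: eq_bigr => i _.
rewrite scalerA mulrC -scalerA; congr (_ *: _).
by elim: (nat_of_ord i) => //= k ->; rewrite linearZ.
Qed.

Lemma pactBr p u v : pact p (u - v) = pact p u - pact p v.
Proof.
rewrite /pact -sumrB; apply: eq_bigr => i _; rewrite -scalerBr; congr (_ *: _).
by elim: (nat_of_ord i) => //= k ->; rewrite linearB.
Qed.

Lemma pactMXsubC p a v : pact (p * ('X - a%:P)) v = pact p (f v - a *: v).
Proof.
rewrite mulrBr pactD pactMX -scaleN1r mulrC mul_polyC !pactZ pactBr pactZr.
by rewrite scaleN1r.
Qed.

Lemma pact_sum p (I : Type) (r : seq I) (P : pred I) (u : I -> V) :
  pact p (\sum_(i <- r | P i) u i) = \sum_(i <- r | P i) pact p (u i).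
Proof.
rewrite /pact exchange_big /=; apply: eq_bigr => k _.
rewrite -scaler_sumr; congr (_ *: _).
elim: (nat_of_ord k) => //= j ->; exact: linear_sum.
Qed.

Lemma pact_eigen p b v : f v = b *: v -> pact p v = p.[b] *: v.
Proof.
move=> fv; rewrite /pact horner_coef scaler_suml; apply: eq_bigr => i _.
suff -> : iter i f v = b ^+ i *: v by rewrite scalerA.
elim: (nat_of_ord i) => [|k /= ->]; first by rewrite scale1r.
by rewrite linearZ /= fv scalerA -exprSr.
Qed.

(** The powers of [f] applied to [v] cannot all be independent. *)
Lemma pact_annihilator v : exists2 p : {poly K}, p != 0 & pact p v = 0.
Proof.
pose n := dim V; pose X := [tuple iter i f v | i < n.+1].
apply: contrapT => noann; have /negP : ~~ free X.
  apply/negP => /eqP Xn; have := dimvS (subvf <<X>>%VS).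
  by rewrite Xn size_tuple dimvf ltnn.
apply; apply/freeP => k k0 i; apply: contrapT => ki; apply: noann.
exists (\poly_(j < n.+1) (if insub j is Some j' then k j' else 0)).
  apply/eqP => /polyP /(_ i); rewrite coef_poly ltn_ord coef0.
  by rewrite valK => /ki.
rewrite (pact_widen _ (size_poly _ _)) -[RHS]k0; apply: eq_bigr => j _.
by rewrite coef_poly ltn_ord valK (nth_map j) ?size_enum_ord // nth_ord_enum.
Qed.

End PolynomialAction.

(** * Spectral decomposition *)

Section Spectral.
Variables (R : realType) (V : vectType R[i]) (dot : {dot V for Num.conj}).
Variable A : 'End(V).
Hypothesis hA : hermitian_op dot A.

Lemma hermitian_eigen_real a v : v != 0 -> A v = a *: v -> a^*%R = a.
Proof.
move=> v0 Av; have := hA v v; rewrite Av linearZl_LR linearZr_LR /=.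
by move/mulIf => /(_ (lt0r_neq0 (neq0_dnorm_gt0 _ v0))) <-.
Qed.

(** A Hermitian operator has no Jordan block of size 2. *)
Lemma hermitian_gen_eigen a v :
  A (A v - a *: v) = a *: (A v - a *: v) -> A v = a *: v.
Proof.
set u := A v - _ => Au; apply/eqP; rewrite -subr_eq0 -/u.
apply: contraT => u0; have ra := hermitian_eigen_real u0 Au.
have : dot u u = 0.
  rewrite {2}/u linearBr /= -hA Au linearZl_LR linearZr_LR /=.
  by rewrite ra subrr.
by move/eqP; rewrite dnorm_eq0 (negbTE u0).
Qed.

(** A vector killed by a product of factors A - a is a sum of eigenvectors: the
    induction removes one factor, and the components of (A - a) v on eigenvalues
    b other than a are lifted by dividing them by b - a. *)
Lemma prodXsubC_decomposition (s : seq R[i]) v :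
  pact A (\prod_(a <- s) ('X - a%:P)) v = 0 ->
  exists2 u : R[i] -> V, forall b, A (u b) = b *: u b
    & v = \sum_(b <- undup s) u b.
Proof.
elim: s v => [|a s IHs] v.
  rewrite big_nil pact1 => ->; exists (fun=> 0); last by rewrite big_nil.
  by move=> b; rewrite linear0 scaler0.
rewrite big_cons mulrC pactMXsubC => /IHs [u Au dec].
pose u1 b := (b - a)^-1 *: u b.
have Au1 b : A (u1 b) = b *: u1 b.
  by rewrite /u1 linearZ /= Au !scalerA mulrC.
pose v1 := v - \sum_(b <- undup s | b != a) u1 b.
have Av1 : A v1 - a *: v1 = \sum_(b <- undup s | b == a) u b.
  rewrite /v1 linearB /= scalerBr scaler_sumr linear_sum /= opprB.
  rewrite [_ - a *: v]addrC addrACA [- _ + _]addrC -[X in _ + X]opprB dec.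
  rewrite (bigID (fun b => b == a)) /= -addrA -!sumrB.
  rewrite [X in _ + X]big1 ?addr0 // => b ba.
  by rewrite Au1 -scalerBl /u1 scalerA mulfV ?subr_eq0 // scale1r subrr.
have Av1a : A v1 = a *: v1.
  apply: hermitian_gen_eigen; rewrite Av1 scaler_sumr linear_sum /=.
  by apply: eq_bigr => b /eqP ->.
exists (fun b => if b == a then v1 else u1 b) => [b|].
  by case: eqP => [->|_].
have -> : v = v1 + \sum_(b <- undup s | b != a) u1 b by rewrite subrK.
have -> : \sum_(b <- undup s | b != a) u1 b =
          \sum_(b <- undup s | b != a) (if b == a then v1 else u1 b).
  by apply: eq_bigr => b /negbTE ->.
rewrite /=; case: ifP => as_; last first.
  rewrite big_cons eqxx; congr (_ + _); rewrite big_seq_cond [RHS]big_seq.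
  apply: eq_bigl => b; rewrite mem_undup; case: eqVneq => [->|_]; last by rewrite andbT.
  by rewrite as_.
by rewrite [RHS](bigD1_seq a) /= ?eqxx ?undup_uniq ?mem_undup.
Qed.

Lemma hermitian_decomposition v :
  exists (s : seq R[i]) (u : R[i] -> V),
    [/\ uniq s, forall b, A (u b) = b *: u b & v = \sum_(b <- s) u b].
Proof.
have [p p0 pv] := pact_annihilator A v.
have [s ps] := closed_field_poly_normal p.
have : pact A (\prod_(a <- s) ('X - a%:P)) v = 0.
  apply/eqP; move/eqP: pv; rewrite ps pactZ scaler_eq0 lead_coef_eq0.
  by rewrite (negbTE p0).
case/prodXsubC_decomposition => u Au dec.
by exists (undup s), u; split=> //; exact: undup_uniq.
Qed.

Lemma hermitian_eigen_ortho (u : R[i] -> V) b c :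
  (forall b, A (u b) = b *: u b) -> b != c -> dot (u b) (u c) = 0.
Proof.
move=> Au bc; have [->|c0] := eqVneq (u c) 0; first exact: linear0r.
have := hA (u b) (u c); rewrite !Au linearZl_LR linearZr_LR /=.
rewrite (hermitian_eigen_real c0 (Au c)) => /eqP.
by rewrite -subr_eq0 -mulrBl mulf_eq0 subr_eq0 (negbTE bc) => /eqP.
Qed.

(** Parseval. *)
Lemma dot_eigen_sum (s : seq R[i]) (u : R[i] -> V) (x y : R[i] -> R[i]) :
  uniq s -> (forall b, A (u b) = b *: u b) ->
  dot (\sum_(b <- s) x b *: u b) (\sum_(b <- s) y b *: u b) =
  \sum_(b <- s) x b * (y b)^*%R * dot (u b) (u b).
Proof.
move=> us Au; rewrite linear_sumlz /= big_seq [RHS]big_seq.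
apply: eq_bigr => b bs; rewrite linear_sumr /= (bigD1_seq b) //= big1 => [|c cb].
  by rewrite addr0 linearZl_LR linearZr_LR /= mulrA.
rewrite linearZl_LR linearZr_LR /= hermitian_eigen_ortho 1?eq_sym //.
by rewrite !mulr0.
Qed.

End Spectral.

(** * Arguments of complex numbers *)

Section Argument.
Variable R : realType.
Implicit Types z : R[i].

Lemma ge0_real_complex z : 0 <= z -> exists2 r : R, 0 <= r & z = r%:C.
Proof.
case: z => a b; rewrite lecE /= => /andP [/eqP -> a0].
by exists a.
Qed.

Lemma normc_sqr z : Normc.normc z ^+ 2 = complex.Re z ^+ 2 + complex.Im z ^+ 2.
Proof. by case: z => a b /=; rewrite sqr_sqrtr // addr_ge0 ?sqr_ge0. Qed.

Lemma normc_normE z : `|z| = (Normc.normc z)%:C. Proof. by []. Qed.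

Lemma normc_ge0 z : 0 <= Normc.normc z.
Proof. by case: z => a b; exact: sqrtr_ge0. Qed.

Lemma normc_gt0 z : z != 0 -> 0 < Normc.normc z.
Proof.
move=> z0; rewrite lt_def normc_ge0 andbT.
by apply: contra_neq z0 => /Normc.eq0_normc.
Qed.

Lemma Re_div_normc_itv z : z != 0 -> -1 <= complex.Re z / Normc.normc z <= 1.
Proof.
move=> z0; have n0 := normc_gt0 z0.
rewrite ler_pdivlMr // ler_pdivrMr // mulN1r mul1r -ler_norml.
rewrite -(@ler_pXn2r _ 2) ?nnegrE ?(ltW n0) // real_normK ?num_real //.
by rewrite normc_sqr lerDl sqr_ge0.
Qed.

Lemma cos_carg z : z != 0 -> cos (carg z) = complex.Re z / Normc.normc z.
Proof.
move=> z0; rewrite /carg (negbTE z0) /=.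
by case: ifP => _; rewrite ?cosN acosK // in_itv /=; exact: Re_div_normc_itv.
Qed.

Lemma sin_carg z : z != 0 -> sin (carg z) = complex.Im z / Normc.normc z.
Proof.
move=> z0; rewrite /carg (negbTE z0) /=; have n0 := normc_gt0 z0.
have sinE : sin (acos (complex.Re z / Normc.normc z)) =
            `|complex.Im z| / Normc.normc z.
  rewrite sin_acos ?Re_div_normc_itv //.
  apply/eqP; rewrite -(@eqrXn2 _ 2) ?sqrtr_ge0 ?divr_ge0 ?normc_ge0 //.
  rewrite sqr_sqrtr; last first.
    by rewrite subr_ge0 -real_normK ?num_real // exprn_ile1 // ler_norml
               Re_div_normc_itv.
  have n2 : Normc.normc z ^+ 2 != 0 by rewrite expf_neq0 ?lt0r_neq0.
  apply/eqP/(mulIf n2); rewrite !expr_div_n real_normK ?num_real //.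
  by rewrite mulrBl mul1r !divfK // normc_sqr; ring.
case: ifP => [im|/negbT]; first by rewrite sinE ger0_norm.
by rewrite -ltNge => im; rewrite sinN sinE ltr0_norm // mulNr opprK.
Qed.

(** Off the closed negative axis, the real part exceeds minus the modulus. *)
Lemma slit_normc_gt z : z != 0 -> - pi < carg z < pi ->
  0 < Normc.normc z + complex.Re z.
Proof.
move=> z0 cz; rewrite ltNge; apply/negP => le0.
have n0 := normc_gt0 z0; have /andP [lo hi] := Re_div_normc_itv z0.
have reE : complex.Re z = - Normc.normc z.
  move: lo; rewrite ler_pdivlMr // mulN1r => lo; lra.
have imE : complex.Im z = 0.
  apply/eqP; rewrite -sqrf_eq0; apply/eqP.
  have := normc_sqr z; rewrite reE sqrrN; lra.
move: cz; rewrite /carg (negbTE z0) imE lexx reE mulNr divff ?lt0r_neq0 //.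
by rewrite acosN1 ltxx andbF.
Qed.

Lemma cos_half_sqr (t : R) : cos (t / 2) ^+ 2 = (1 + cos t) / 2.
Proof.
have := cosD (t / 2) (t / 2); have := cos2Dsin2 (t / 2).
by rewrite -splitr => h ->; rewrite -!expr2; lra.
Qed.

Lemma cos_half_gt0 (t : R) : - pi < t < pi -> 0 < cos (t / 2).
Proof.
by move=> /andP [lo hi]; apply: cos_gt0_pihalf; apply/andP; split; lra.
Qed.

(** Rotating by minus half the argument of [z] sends the two terms of [z * a + b]
    to numbers whose arguments are opposite, hence have the same cosine. *)
Lemma sector_lower_bound z (a b : R) : 0 <= a -> 0 <= b ->
  - pi < carg z < pi ->
  (cos (carg z / 2) * (Normc.normc z * a + b))%:C <= `|z * a%:C + b%:C|.
Proof.
move=> a0 b0 cz; rewrite normc_normE lecR.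
have k0 := cos_half_gt0 cz; have n0 := normc_ge0 z.
rewrite -(@ler_pXn2r _ 2) ?nnegrE ?normc_ge0 //; last first.
  by rewrite mulr_ge0 ?addr_ge0 ?mulr_ge0 ?(ltW k0).
rewrite exprMn cos_half_sqr normc_sqr.
have [->|z0] := eqVneq z 0.
  rewrite Normc.normc0 /carg eqxx cos0 !mul0r !add0r /= expr0n /=; lra.
rewrite cos_carg //; have {}n0 := normc_gt0 z0; have nE := normc_sqr z.
have /andP [_ ] := Re_div_normc_itv z0.
set c := _ / _; have cE : complex.Re z = c * Normc.normc z.
  by rewrite /c divfK // lt0r_neq0.
move=> c1; move: nE cE; case: (z) => x y /= .
rewrite !mulr0 subr0 !add0r addr0.
set n := Num.sqrt _ => nE cE.
have -> : (x * a + b) ^+ 2 + (y * a) ^+ 2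
   = (n * a) ^+ 2 + b ^+ 2 + 2 * (n * a) * b * c.
  by rewrite [(n * a) ^+ 2]exprMn nE cE; ring.
have := mulr_ge0 (_ : 0 <= 1 - c) (sqr_ge0 (n * a - b)).
rewrite subr_ge0 => /(_ c1); lra.
Qed.

End Argument.

(** * Energy estimates *)

(** Cauchy's inequality for two positive forms gives it for their sum. *)
Lemma CauchySchwarz_add (R : realFieldType) (p q a1 a2 b1 b2 : R) :
  0 <= p -> 0 <= q -> 0 <= a1 -> 0 <= a2 -> 0 <= b1 -> 0 <= b2 ->
  p ^+ 2 <= a1 * b1 -> q ^+ 2 <= a2 * b2 ->
  (p + q) ^+ 2 <= (a1 + a2) * (b1 + b2).
Proof.
move=> p0 q0 a10 a20 b10 b20 hp hq.
have pq : 2 * (p * q) <= a1 * b2 + a2 * b1.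
  rewrite -(@ler_pXn2r _ 2) ?nnegrE ?addr_ge0 ?mulr_ge0 //.
  have := ler_pM (sqr_ge0 p) (sqr_ge0 q) hp hq.
  have := sqr_ge0 (a1 * b2 - a2 * b1); lra.
lra.
Qed.

(** Coercivity (constant k) and boundedness together bound the energy E of the
    Galerkin error by that of a competitor, X. *)
Lemma coercive_bound (R : realFieldType) (k E X N : R) :
  0 < k -> 0 <= E -> 0 <= X -> N ^+ 2 <= E * X -> k * E <= N -> E * k ^+ 2 <= X.
Proof.
move=> k0; rewrite le_eqVlt => /predU1P [<-|E0] X0 NEX kEN.
  by rewrite mul0r.
rewrite -(ler_pM2l E0) (le_trans _ NEX) //.
have -> : E * (E * k ^+ 2) = (k * E) ^+ 2 by ring.
have kE0 : 0 <= k * E by rewrite mulr_ge0 ?(ltW k0) ?(ltW E0).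
by rewrite ler_pXn2r ?nnegrE // (le_trans kE0).
Qed.

Section Energy.
Variables (R : realType) (V : vectType R[i]) (dot : {dot V for Num.conj}).
Implicit Types (P B : 'End(V)) (zt : R[i]) (x y e : V).

Lemma dotC x y : dot y x = (dot x y)^*%R.
Proof. by rewrite hermC /= expr0 mul1r. Qed.

Lemma posdef_ge0 P x : posdef_op dot P -> 0 <= dot (P x) x.
Proof.
move=> pP; have [->|x0] := eqVneq x 0; first by rewrite linear0r.
by rewrite ltW // pP.
Qed.

Lemma posdef_CauchySchwarz P x y : hermitian_op dot P -> posdef_op dot P ->
  `|dot (P x) y| ^+ 2 <= dot (P x) x * dot (P y) y.
Proof.
move=> hP pP; have [->|y0] := eqVneq y 0.
  by rewrite !linear0r normr0 expr0n /= mulr0.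
set a := dot (P x) x; set b := dot (P x) y; set c := dot (P y) y.
have c0 : 0 < c by exact: pP.
have cr : c^*%R = c by apply: conj_Creal; rewrite realE ltW.
have bC : dot (P y) x = b^*%R by rewrite hP dotC.
have := posdef_ge0 (c *: x - b *: y) pP.
have -> : P (c *: x - b *: y) = c *: P x - b *: P y by rewrite linearB !linearZ.
rewrite linearBl /= !linearBr /= !linearZl_LR !linearZr_LR /=.
rewrite -/a -/b -/c bC cr.
have -> : c * (c * a) - c * (b^*%R * b) - (b * (c * b^*%R) - b * (b^*%R * c)) =
          c * (a * c - b * b^*%R) by ring.
by rewrite pmulr_rge0 // subr_ge0 -normCK.
Qed.

(** The square of [tnorm]. *)
Definition energy B zt x : R[i] := `|zt| * dot x x + dot (B x) x.

Lemma energy_ge0 B zt x : posdef_op dot B -> 0 <= energy B zt x.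
Proof. by move=> pB; rewrite addr_ge0 ?mulr_ge0 ?posdef_ge0. Qed.

Lemma energy_CauchySchwarz B zt x y : hermitian_op dot B -> posdef_op dot B ->
  `|dot (zt *: x + B x) y| ^+ 2 <= energy B zt x * energy B zt y.
Proof.
move=> hB pB; rewrite /energy linearDl /= linearZl_LR /=.
apply: (@le_trans _ _ ((`|zt| * `|dot x y| + `|dot (B x) y|) ^+ 2)).
  rewrite ler_pXn2r ?nnegrE ?addr_ge0 ?mulr_ge0 //.
  by rewrite (le_trans (ler_normD _ _)) // normrM.
have := posdef_CauchySchwarz x y hB pB.
have [cs _] := CauchySchwarz dot x y; move: cs.
have := posdef_ge0 x pB; have := posdef_ge0 y pB.
move: (normr_ge0 zt) (normr_ge0 (dot x y)) (normr_ge0 (dot (B x) y)).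
move: (dnorm_ge0 dot x) (dnorm_ge0 dot y).
do 7 (case/ge0_real_complex => ? ? ->).
rewrite -!(rmorphXn, rmorphM, rmorphD) /= !lecR => ? ?.
apply: CauchySchwarz_add; rewrite ?mulr_ge0 //.
rewrite [leRHS]mulrACA -expr2 exprMn ler_wpM2l ?sqr_ge0 //.
Qed.

Lemma coercive B zt x : posdef_op dot B -> - pi < carg zt < pi ->
  (cos (carg zt / 2))%:C * energy B zt x <= `|dot (zt *: x + B x) x|.
Proof.
move=> pB cz; rewrite /energy linearDl /= linearZl_LR /= normc_normE.
have [a a0 ->] := ge0_real_complex (dnorm_ge0 dot x).
have [b b0 ->] := ge0_real_complex (posdef_ge0 x pB).
by rewrite -!(rmorphM, rmorphD) sector_lower_bound.
Qed.

(** The Galerkin error is quasi-optimal; the factor comes from the coercivity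
    constant, the form being bounded by 1 in the energy norm. *)
Lemma galerkin_quasi_optimal B zt (K : {vspace V}) e x :
  hermitian_op dot B -> posdef_op dot B -> - pi < carg zt < pi ->
  (forall phi, phi \in K -> dot (zt *: e + B e) phi = 0) -> x - e \in K ->
  tnorm dot B zt e <= ((cos (carg zt / 2))^-1)%:C * tnorm dot B zt x.
Proof.
move=> hB pB cz orth xe; rewrite /tnorm -![_ + dot (B _) _]/(energy B zt _).
have k0 := cos_half_gt0 cz; have := coercive e pB cz.
have -> : dot (zt *: e + B e) e = dot (zt *: e + B e) x.
  have := orth _ xe; rewrite linearBr /= => /eqP.
  by rewrite subr_eq0 => /eqP.
have := energy_CauchySchwarz zt e x hB pB.
have e0 := energy_ge0 zt e pB; have x0 := energy_ge0 zt x pB.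
have kC : 0 <= ((cos (carg zt / 2))^-1)%:C by rewrite ler0c invr_ge0 ltW.
rewrite -(@ler_pXn2r _ 2 _ (sqrtC _)) ?nnegrE ?mulr_ge0 ?sqrtC_ge0 //.
rewrite exprMn !sqrtCK; move: e0 x0 (normr_ge0 (dot (zt *: e + B e) x)).
do 3 (case/ge0_real_complex => ? ? ->).
rewrite -!(rmorphXn, rmorphM) /= !lecR exprVn => cs co.
rewrite mulrC ler_pdivlMr ?exprn_gt0 //.
exact: coercive_bound k0 _ _ cs co.
Qed.

End Energy.

(** * Well-posedness of the Galerkin problems *)

Section Galerkin.
Variables (R : realType) (V : vectType R[i]) (dot : {dot V for Num.conj}).

(** The Gram matrix of the problem on a basis of K is injective, hence
    invertible. *)
Lemma galerkin_solvable (T : 'End(V)) (K : {vspace V}) (r : V) :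
  (forall v, dot (T v) v = 0 -> v = 0) ->
  exists2 v, v \in K & forall phi, phi \in K -> dot (T v) phi = dot r phi.
Proof.
move=> T0; pose k := \dim K; pose X := vbasis K.
pose lc (c : 'rV[R[i]]_k) : V := \sum_(i < k) c 0 i *: X`_i.
pose G : 'M[R[i]]_k := \matrix_(i, j) dot (T X`_i) X`_j.
have XK (i : 'I_k) : X`_i \in K by rewrite vbasis_mem ?mem_nth ?size_tuple.
have lcK c : lc c \in K by rewrite memv_suml // => i _; rewrite memvZ.
have lcG c j : dot (T (lc c)) X`_(nat_of_ord j) = (c *m G) 0 j.
  rewrite mxE /lc linear_sum /= linear_sumlz /=; apply: eq_bigr => i _.
  by rewrite linearZ /= linearZl_LR mxE.
(* a vector is tested against K by testing it against the basis of K *)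
have test u u' : (forall j : 'I_k, dot u X`_j = dot u' X`_j) ->
    forall phi, phi \in K -> dot u phi = dot u' phi.
  move=> eqX phi phiK; rewrite (coord_vbasis phiK) !linear_sumr /=.
  by apply: eq_bigr => j _; rewrite !linearZr_LR /= eqX.
have Gu : G \in unitmx.
  rewrite -row_free_unit; apply: inj_row_free => c cG.
  have lc0 : lc c = 0.
    apply: T0; transitivity (dot 0 (lc c)); last by rewrite linear0l.
    apply: test => // j.
    by rewrite lcG cG mxE linear0l.
  have /freeP fX : free X by exact: basis_free (vbasisP K).
  by apply/rowP => i; rewrite mxE (fX (fun i => c 0 i)).
exists (lc ((\row_j dot r X`_j) *m invmx G)) => //.
by apply: test => j; rewrite lcG mulmxKV // mxE.
Qed.

Lemma cg_iterateP (B : 'End(V)) zt g w0 n : posdef_op dot B ->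
  - pi < carg zt < pi ->
  is_cg_iterate dot B zt g w0 n (cg_iterate dot B zt g w0 n).
Proof.
move=> pB cz.
apply: (@xgetPex _ w0 [set w | is_cg_iterate dot B zt g w0 n w]%classic).
pose T : 'End(V) := (zt *: \1 + B)%VF.
have TE v : T v = zt *: v + B v by rewrite /T !lfun_simp.
have [|v vK vr] := @galerkin_solvable T (krylov B (cg_residual B zt g w0) n)
    (cg_residual B zt g w0).
  (* by coercivity, the form vanishes on the diagonal only at 0 *)
  move=> v; rewrite TE => v0; apply/eqP; apply: contraT => vn0.
  have := coercive v pB cz; rewrite v0 normr0 pmulr_rle0; last first.
    by rewrite ltcR cos_half_gt0.
  by move/le_gtF => <-; rewrite /energy ltr_wpDl ?mulr_ge0 ?pB.
exists (w0 + v); split; first by rewrite addrC addKr.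
move=> phi phiK; have := vr phi phiK; rewrite TE /cg_residual.
rewrite [B (w0 + v)]linearD /= scalerDr addrACA.
rewrite [dot (_ + (_ + B v)) _]linearDl /= => ->.
by rewrite linearBl /= [LHS]addrC subrK.
Qed.

End Galerkin.

(** * Polynomial bounds for the error *)

Section ErrorBound.
Variables (R : realType) (V : vectType R[i]) (dot : {dot V for Num.conj}).
Variables (B : 'End(V)) (zt : R[i]).
Hypotheses (hB : hermitian_op dot B) (pB : posdef_op dot B).

Lemma energy_eigen_sum (s : seq R[i]) (u x : R[i] -> _) :
  uniq s -> (forall b, B (u b) = b *: u b) ->
  energy dot B zt (\sum_(b <- s) x b *: u b) =
  \sum_(b <- s) `|x b| ^+ 2 * energy dot B zt (u b).
Proof.
move=> us Bu; rewrite /energy.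
have -> : B (\sum_(b <- s) x b *: u b) = \sum_(b <- s) (x b * b) *: u b.
  by rewrite linear_sum; apply: eq_bigr => b _; rewrite linearZ /= Bu scalerA.
rewrite !(dot_eigen_sum hB _ _ us Bu) mulr_sumr -big_split /=.
apply: eq_bigr => b _; rewrite Bu linearZl_LR /= normCK; ring.
Qed.

Lemma tnorm_pact (q : {poly R[i]}) (k : R[i]) v : 0 <= k ->
  (forall b u, u != 0 -> B u = b *: u -> `|q.[b]| <= k) ->
  tnorm dot B zt (pact B q v) <= k * tnorm dot B zt v.
Proof.
move=> k0 qk; rewrite /tnorm -![_ + dot (B _) _]/(energy dot B zt _).
rewrite -(@ler_pXn2r _ 2) ?nnegrE ?mulr_ge0 ?sqrtC_ge0 ?energy_ge0 //.
rewrite exprMn !sqrtCK.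
have [s [u [us Bu ->]]] := hermitian_decomposition hB v.
have -> : pact B q (\sum_(b <- s) u b) = \sum_(b <- s) q.[b] *: u b.
  by rewrite pact_sum; apply: eq_bigr => b _; rewrite (pact_eigen _ (Bu b)).
have -> : \sum_(b <- s) u b = \sum_(b <- s) (1 : R[i]) *: u b.
  by apply: eq_bigr => b _; rewrite scale1r.
rewrite (energy_eigen_sum (fun b => q.[b]) us Bu).
rewrite (energy_eigen_sum (fun=> 1) us Bu) mulr_sumr; apply: ler_sum => b _.
rewrite normr1 expr1n mul1r; have [->|ub0] := eqVneq (u b) 0.
  by rewrite /energy !linear0r mulr0 addr0 !mulr0.
by rewrite ler_wpM2r ?energy_ge0 // ler_pXn2r ?nnegrE // (qk _ _ ub0).
Qed.

(** The errors reachable by step n are the q(B) e_0, for polynomials q of degree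
    at most n with q(- zt) = 1: then q - 1 is divisible by X + zt, and
    (zt + B) e_0 is minus the initial residual. *)
Lemma krylov_error (q : {poly R[i]}) n g w0 w wn :
  zt *: w + B w = zt *: B g -> (size q <= n.+1)%N -> q.[- zt] = 1 ->
  is_cg_iterate dot B zt g w0 n wn ->
  pact B q (w0 - w) - (wn - w) \in krylov B (cg_residual B zt g w0) n.
Proof.
move=> wE sq q1 [wnK _]; set r0 := cg_residual B zt g w0 in wnK *.
have /factor_theorem [p pE] : root (q - 1) (- zt).
  by rewrite rootE !hornerE q1 subrr.
have -> : q = p * ('X - (- zt)%:P) + 1 by rewrite -pE subrK.
rewrite pactD pactMXsubC pact1 scaleNr opprK.
have -> : B (w0 - w) + zt *: (w0 - w) = -1 *: r0.
  rewrite /r0 /cg_residual -wE scaleN1r opprB opprD addrACA linearB scalerBr.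
  exact: addrC.
rewrite pactZr -addrA.
have -> : w0 - w - (wn - w) = - (wn - w0) by rewrite !opprB subrKA.
apply: rpredB => //; apply: rpredZ.
(* the cofactor of X + zt has degree less than n *)
have sp : (size p <= n)%N.
  have [->|p0] := eqVneq p 0; first by rewrite size_poly0.
  have szM : size (p * ('X - (- zt)%:P))%R = (size p).+1.
    by rewrite size_Mmonic ?monicXsubC // size_XsubC addn2.
  rewrite -ltnS -szM -pE (leq_trans (size_polyD _ _)) // geq_max sq.
  by rewrite size_polyN size_poly1.
rewrite (pact_widen _ _ sp); apply: rpred_sum => i _; apply: rpredZ.
apply: memv_span; apply/mapP; exists (nat_of_ord i) => //.
by rewrite mem_iota /= add0n.
Qed.

Lemma cg_iterate0 g w0 :
  - pi < carg zt < pi -> cg_iterate dot B zt g w0 0 = w0.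
Proof.
move=> cz; have [] := cg_iterateP g w0 0 pB cz.
by rewrite /krylov /= span_nil memv0 subr_eq0 => /eqP.
Qed.

Lemma cg_error_poly (q : {poly R[i]}) (k : R[i]) n g w0 w :
  - pi < carg zt < pi -> zt *: w + B w = zt *: B g ->
  (size q <= n.+1)%N -> q.[- zt] = 1 -> 0 <= k ->
  (forall b u, u != 0 -> B u = b *: u -> `|q.[b]| <= k) ->
  tnorm dot B zt (cg_iterate dot B zt g w0 n - w) <=
    ((cos (carg zt / 2))^-1)%:C * k * tnorm dot B zt (w0 - w).
Proof.
move=> cz wE sq q1 k0 qk; have itn := cg_iterateP g w0 n pB cz.
have kin := krylov_error wE sq q1 itn; case: itn => _ orth.
apply: le_trans (galerkin_quasi_optimal hB pB cz _ kin) _.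
  move=> phi phiK; rewrite [B (_ - w)]linearB /= scalerBr addrACA -opprD wE.
  by rewrite linearBl /= orth // subrr.
rewrite -mulrA ler_wpM2l ?tnorm_pact //.
by rewrite ler0c invr_ge0 ltW ?cos_half_gt0.
Qed.

End ErrorBound.

(** * Tchebyshev polynomials *)

Section Chebyshev.
Variable R : realType.
Implicit Types (z theta E : R[i]) (t x : R).

Lemma cexpD z1 z2 : cexp (z1 + z2) = cexp z1 * cexp z2.
Proof.
case: z1 z2 => [a b] [c d]; rewrite /cexp /= expRD sinD cosD rmorphM /=.
rewrite mulrACA; congr (_ * _); apply/eqP; rewrite eq_complex /=.
by rewrite eqxx /= [sin b * cos d + _]addrC.
Qed.

Lemma cexp0 : cexp 0 = 1 :> R[i].
Proof. by rewrite /cexp /= expR0 cos0 sin0 mulr1. Qed.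

Lemma cexp_neq0 z : cexp z != 0.
Proof.
apply/eqP => z0; have := cexpD z (- z).
by rewrite subrr cexp0 z0 mul0r => /eqP; rewrite oner_eq0.
Qed.

Lemma cexpN z : cexp (- z) = (cexp z)^-1.
Proof.
apply: (mulfI (cexp_neq0 z)).
by rewrite -cexpD subrr cexp0 mulfV ?cexp_neq0.
Qed.

Lemma cexp_natmul n z : cexp (n%:R * z) = cexp z ^+ n.
Proof.
elim: n => [|n IHn]; first by rewrite mul0r cexp0.
by rewrite -natr1 mulrDl mul1r cexpD IHn exprSr.
Qed.

Lemma cexp_surj E : E != 0 -> exists z, cexp z = E.
Proof.
move=> E0; exists (ln (Normc.normc E) +i* carg E).
rewrite /cexp /= lnK ?posrE ?normc_gt0 // cos_carg // sin_carg //.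
have n0 : Normc.normc E != 0 by rewrite lt0r_neq0 ?normc_gt0.
apply/eqP; rewrite eq_complex /= !mul0r subr0 addr0.
by rewrite ![Normc.normc E * _]mulrC !divfK ?eqxx.
Qed.

Lemma ccosE theta :
  ccos theta = (cexp ('i * theta) + (cexp ('i * theta))^-1) / 2%:R.
Proof. by rewrite /ccos cexpN. Qed.

Lemma ccos_natmul n theta : let E := cexp ('i * theta) in
  ccos (n%:R * theta) = (E ^+ n + E ^- n) / 2%:R.
Proof. by rewrite /= ccosE mulrCA cexp_natmul. Qed.

Lemma ccos_real t : ccos t%:C = (cos t)%:C.
Proof.
rewrite /ccos -complexiE.
have -> : 'i%C * t%:C = 0 +i* t :> R[i].
  by apply/eqP; rewrite eq_complex /= !mul0r !mul1r subr0 add0r !eqxx.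
have -> : - (0 +i* t) = 0 +i* (- t) :> R[i].
  by apply/eqP; rewrite eq_complex /= oppr0 !eqxx.
rewrite /cexp /= expR0 !mul1r cosN sinN.
have -> : cos t +i* sin t + cos t +i* (- sin t) = (cos t)%:C * 2%:R :> R[i].
  rewrite mulr_natr mulr2n; apply/eqP; rewrite eq_complex /=.
  by rewrite subrr addr0 !eqxx.
by rewrite mulfK // pnatr_eq0.
Qed.

(** The Tchebyshev polynomials given by their three-term recurrence; they serve
    to show that [tchebyshev] is not its default value. *)
Fixpoint cheb n : {poly R[i]} :=
  if n is n1.+1 then
    if n1 is n2.+1 then 2%:R *: (cheb n1 * 'X) - cheb n2 else 'X
  else 1.

Lemma cheb_rec n : cheb n.+2 = 2%:R *: (cheb n.+1 * 'X) - cheb n.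
Proof. by []. Qed.

Lemma size_cheb n : size (cheb n) = n.+1.
Proof.
suff [] : size (cheb n) = n.+1 /\ size (cheb n.+1) = n.+2 by [].
elim: n => [|n [IH0 IH1]]; first by rewrite /= size_poly1 size_polyX.
split=> //; have c0 : cheb n.+1 != 0 by rewrite -size_poly_eq0 IH1.
have szX : size (2%:R *: (cheb n.+1 * 'X)) = n.+3.
  by rewrite size_scale ?pnatr_eq0 // size_mulX // IH1.
by rewrite cheb_rec size_polyDl szX // size_polyN IH0.
Qed.

Lemma cheb_eval n E : E != 0 ->
  (cheb n).[(E + E^-1) / 2%:R] = (E ^+ n + E ^- n) / 2%:R.
Proof.
move=> E0; set x := _ / _.
suff [] : (cheb n).[x] = (E ^+ n + E ^- n) / 2%:R /\
          (cheb n.+1).[x] = (E ^+ n.+1 + E ^- n.+1) / 2%:R by [].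
elim: n => [|n [IH0 IH1]].
  by rewrite /= !hornerE expr0 invr1 expr1 -mulr2n mulfV // pnatr_eq0.
split=> //; rewrite cheb_rec hornerD hornerN hornerZ hornerMX IH0 IH1 /x.
have En : E ^+ n != 0 by rewrite expf_neq0.
by rewrite !exprS; field; rewrite E0 En.
Qed.

Lemma tchebyshevP n : is_tchebyshev n (tchebyshev R n).
Proof.
apply: (@xgetPex _ 0 [set p : {poly R[i]} | is_tchebyshev n p]%classic).
exists (cheb n); split; first exact: size_cheb.
by move=> theta; rewrite ccos_natmul ccosE cheb_eval ?cexp_neq0.
Qed.

Lemma tchebyshev_eval n E : E != 0 ->
  (tchebyshev R n).[(E + E^-1) / 2%:R] = (E ^+ n + E ^- n) / 2%:R.
Proof.
move=> E0; have [z zE] := cexp_surj E0.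
pose theta : R[i] := - ('i * z).
have iE : 'i * theta = z by rewrite /theta mulrN mulrA -expr2 sqrCi mulN1r opprK.
have [_ /(_ theta)] := tchebyshevP n.
by rewrite ccos_natmul ccosE iE zE.
Qed.

Lemma tchebyshev_le1 n x : -1 <= x <= 1 -> `|(tchebyshev R n).[x%:C]| <= 1.
Proof.
move=> x1; have [_ /(_ (acos x)%:C)] := tchebyshevP n.
rewrite ccos_real acosK ?in_itv //= => ->.
have -> : n%:R * (acos x)%:C = (n%:R * acos x)%:C :> R[i].
  by rewrite rmorphM rmorph_nat.
rewrite ccos_real normc_def /= expr0n addr0 sqrtr_sqr -(rmorph1 (real_complex R)).
by rewrite lecR ler_norml cos_geN1 cos_le1.
Qed.

(** For E in the punctured unit disk and positive n, the terms E^n and E^-n have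
    different moduli. *)
Lemma tchebyshev_neq0 n E : E != 0 -> `|E| < 1 ->
  (tchebyshev R n).[(E + E^-1) / 2%:R] != 0.
Proof.
move=> E0 E1; rewrite tchebyshev_eval // mulf_neq0 ?invr_neq0 ?pnatr_eq0 //.
case: n => [|n]; first by rewrite expr0 invr1 -mulr2n pnatr_eq0.
rewrite addr_eq0; apply/eqP => /(congr1 Num.norm).
rewrite normrN normfV normrX => eqn.
have lt1 : `|E| ^+ n.+1 < 1 by rewrite exprn_ilt1.
have gt0 : 0 < `|E| ^+ n.+1 by rewrite exprn_gt0 ?normr_gt0.
have : 1 < (`|E| ^+ n.+1)^-1 by rewrite invf_gt1.
by rewrite -eqn => /(lt_trans lt1); rewrite ltxx.
Qed.

End Chebyshev.

(** * The quotient of square roots *)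

Section Eta.
Variable R : realType.
Implicit Types (z : R[i]) (s t : R).

(** The square of the real part of the root is (|t + z| + Re (t + z)) / 2, which
    is nondecreasing in t; the lower bound is its value at t = 0. *)
Lemma sqrtc_shiftP t z : 0 <= t -> z != 0 ->
  let a := sqrtc (t%:C + z) in let n := Normc.normc z in
  [/\ Normc.normc a ^+ 2 <= t + n, 0 <= complex.Re a
    & (n + complex.Re z) / 2 <= complex.Re a ^+ 2].
Proof.
case: z => x y t0 z0 a n; have n0 : 0 < n by exact: normc_gt0.
have nE : n ^+ 2 = x ^+ 2 + y ^+ 2 by exact: (normc_sqr (x +i* y)).
pose r := Normc.normc ((t + x) +i* y); have aE : Normc.normc a ^+ 2 = r.
  rewrite expr2 -Normc.normcM -expr2 sqr_sqrtc; congr Normc.normc.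
  by apply/eqP; rewrite eq_complex /= add0r !eqxx.
have r0 : 0 <= r by exact: normc_ge0.
have rE : r ^+ 2 = (t + x) ^+ 2 + y ^+ 2.
  exact: (normc_sqr ((t + x) +i* y)).
have [xn nx] : x <= n /\ - n <= x by split; nra.
have rle : r <= t + n by nra.
have rge : n <= r + t by nra.
rewrite aE; split=> //; first exact: sqrtr_ge0.
rewrite /a /sqrtc /= add0r -[Num.sqrt (_ + y ^+ 2)]/r sqr_sqrtr; lra.
Qed.

Lemma Im_sqrtc_shift_mul s t z :
  0 <= complex.Im (sqrtc (s%:C + z)) * complex.Im (sqrtc (t%:C + z)).
Proof.
case: z => x y; rewrite /sqrtc /= add0r mulrACA -expr2.
by rewrite mulr_ge0 ?sqr_ge0 ?mulr_ge0 ?sqrtr_ge0.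
Qed.

Lemma normc_sqrtc_ratio s t z : 0 <= s -> s <= t -> z != 0 ->
  0 < Normc.normc z + complex.Re z ->
  Normc.normc ((sqrtc (t%:C + z) - sqrtc (s%:C + z)) /
               (sqrtc (t%:C + z) + sqrtc (s%:C + z))) <=
    Num.sqrt ((2 * t + Normc.normc z - complex.Re z) /
              (2 * t + 3 * Normc.normc z + complex.Re z)).
Proof.
move=> s0 st z0 nx; have t0 := le_trans s0 st.
set a := sqrtc (t%:C + z); set b := sqrtc (s%:C + z).
set n := Normc.normc z; set x := complex.Re z.
have [an a0 ax] := sqrtc_shiftP t0 z0; have [bn b0 bx] := sqrtc_shiftP s0 z0.
have im := Im_sqrtc_shift_mul t s z.
rewrite -/a -/b -/n -/x in an a0 ax bn b0 bx im nx.
have n0 : 0 <= n by exact: normc_ge0.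
rewrite -[leLHS]ger0_norm ?normc_ge0 // -sqrtr_sqr ler_sqrt; last first.
  have := normc_gt0 z0; rewrite -/n => n0'.
  have : `|x| <= n.
    rewrite -(@ler_pXn2r _ 2) ?nnegrE // real_normK ?num_real // normc_sqr.
    by rewrite lerDl sqr_ge0.
  rewrite ler_norml => /andP [lo hi]; apply: divr_ge0; lra.
rewrite Normc.normcM Normc.normcV expr_div_n.
set P := complex.Re a * complex.Re b + complex.Im a * complex.Im b.
set S := Normc.normc a ^+ 2 + Normc.normc b ^+ 2.
have -> : Normc.normc (a - b) ^+ 2 = S - 2 * P.
  rewrite /S /P !normc_sqr; case: (a) (b) => [? ?] [? ?] /=; ring.
have -> : Normc.normc (a + b) ^+ 2 = S + 2 * P.
  rewrite /S /P !normc_sqr; case: (a) (b) => [? ?] [? ?] /=; ring.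
have Px : (n + x) / 2 <= P.
  have : (n + x) / 2 <= complex.Re a * complex.Re b.
    have m0 : 0 <= (n + x) / 2 by lra.
    rewrite -(@ler_pXn2r _ 2) ?nnegrE ?m0 ?mulr_ge0 //.
    by rewrite [leRHS]exprMn [leLHS]expr2 ler_pM.
  rewrite /P; lra.
have SM : S <= 2 * t + 2 * n by rewrite /S; lra.
have S0 : 0 <= S by rewrite addr_ge0 ?sqr_ge0.
rewrite ler_pdivrMr; last lra.
rewrite [leRHS]mulrAC ler_pdivlMr; last lra.
have -> : 2 * t + n - x = (2 * t + 2 * n) - (n + x) by ring.
have -> : 2 * t + 3 * n + x = (2 * t + 2 * n) + (n + x) by ring.
have : S * (n + x) <= (2 * t + 2 * n) * (2 * P) by rewrite ler_pM //; lra.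
lra.
Qed.

End Eta.

(** The affine map sending the interval between a and b onto [-1, 1]. *)
Definition to_unit_itv (R : realType) (a b : R) : {poly R[i]} :=
  (b%:C - a%:C)^-1 *: (2%:R *: 'X - (a%:C + b%:C)%:P).

Lemma horner_to_unit_itv (R : realType) (a b : R) (x : R[i]) :
  (to_unit_itv a b).[x] = (2%:R * x - (a%:C + b%:C)) / (b%:C - a%:C).
Proof. by rewrite !hornerE mulrC. Qed.

Lemma horner_to_unit_itv_real (R : realType) (a b r : R) :
  (to_unit_itv a b).[r%:C] = ((2 * r - (a + b)) / (b - a))%:C.
Proof.
rewrite horner_to_unit_itv !rmorphM fmorphV !rmorphB rmorphM.
by rewrite rmorph_nat rmorphD.
Qed.

Lemma size_to_unit_itv (R : realType) (a b : R) :
  (size (to_unit_itv a b) <= 2)%N.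
Proof.
rewrite (leq_trans (size_scale_leq _ _)) // (leq_trans (size_polyD _ _)) //.
rewrite geq_max (leq_trans (size_scale_leq _ _)) ?size_polyX //=.
by rewrite size_polyN (leq_trans (size_polyC_leq1 _)).
Qed.

(** * The spectrum of the resolvent *)

Section Resolvent.
Variables (R : realType) (V : vectType R[i]) (dot : {dot V for Num.conj}).
Variables (A : 'End(V)) (l1 lN mu : R).
Hypotheses (hA : hermitian_op dot A) (mul1_gt0 : 0 < mu + l1).
Hypotheses (minA : smallest_eigenvalue A l1) (maxA : largest_eigenvalue A lN).

Let S : 'End(V) := (mu%:C *: \1 + A)%VF.
Let B : 'End(V) := (S^-1)%VF.

Let SE v : S v = mu%:C *: v + A v. Proof. by rewrite /S !lfun_simp. Qed.

Lemma eigen_bounds a v : v != 0 -> A v = a *: v ->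
  exists2 r : R, a = r%:C & l1 <= r <= lN.
Proof.
move=> v0 Av; have ev : passmx.leigenvalue A a.
  apply/negP => /eqP kerA; move: v0; rewrite -memv0 -kerA memv_ker.
  by rewrite !lfun_simp Av subrr eqxx.
have := minA.2 a ev; have := maxA.2 a ev; case: a {Av ev} => x y.
rewrite !lecE /= => /andP [/eqP y0 lex] /andP [_ xle].
by exists x; rewrite -?y0 // lex xle.
Qed.

Lemma resolvent_inj : lker S == 0%VS.
Proof.
apply/lker0P => v w Svw; apply/eqP; rewrite -subr_eq0; apply: contraT => vw0.
have Avw : A (v - w) = (- mu%:C) *: (v - w).
  apply/eqP; rewrite scaleNr -subr_eq0 opprK addrC -SE.
  by rewrite [S _]linearB /= Svw subrr.
have [r rE /andP [lr _]] := eigen_bounds vw0 Avw.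
have {}rE : r = - mu by move: rE; rewrite -rmorphN => /complexI.
by move: lr; rewrite rE -subr_le0 opprK addrC leNgt mul1_gt0.
Qed.

Lemma resolvent_hermitian : hermitian_op dot B.
Proof.
move=> u v; rewrite -{2}(lker0_lfunVK resolvent_inj u).
rewrite -{1}(lker0_lfunVK resolvent_inj v) -/B !SE.
rewrite linearDl linearDr /= linearZl_LR linearZr_LR /= hA.
by rewrite conj_Creal // complex_real.
Qed.

Lemma resolvent_eigen b v : v != 0 -> B v = b *: v ->
  exists2 r : R, b = r%:C & (mu + lN)^-1 <= r <= (mu + l1)^-1.
Proof.
move=> v0 Bv; have vE : v = b *: S v.
  by rewrite -linearZ /= -Bv (lker0_lfunVK resolvent_inj).
have b0 : b != 0 by apply: contraNneq v0 => b0; rewrite vE b0 scale0r.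
have Av : A v = (b^-1 - mu%:C) *: v.
  have : S v = b^-1 *: v by rewrite {2}vE scalerA mulVf // scale1r.
  by rewrite SE scalerBl => <-; rewrite addrC addKr.
have [r rE /andP [lo hi]] := eigen_bounds v0 Av.
exists (mu + r)^-1.
  by rewrite fmorphV rmorphD /= -rE addrC subrK invrK.
have p1 : 0 < mu + r by rewrite (lt_le_trans mul1_gt0) ?lerD2l.
have p2 : 0 < mu + lN by rewrite (lt_le_trans p1) ?lerD2l.
by rewrite !lef_pV2 // !lerD2l hi.
Qed.

Lemma resolvent_posdef : posdef_op dot B.
Proof.
move=> v v0; have hB := resolvent_hermitian.
have [s [u [us Bu vE]]] := hermitian_decomposition hB v.
have -> : dot (B v) v = \sum_(b <- s) dot (B (u b)) (u b).
  have -> : v = \sum_(b <- s) (1 : R[i]) *: u b.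
    by rewrite vE; apply: eq_bigr => b _; rewrite scale1r.
  have -> : B (\sum_(b <- s) (1 : R[i]) *: u b) = \sum_(b <- s) b *: u b.
    by rewrite linear_sum; apply: eq_bigr => b _; rewrite linearZ /= Bu scale1r.
  rewrite (dot_eigen_sum hB (fun b => b) (fun=> 1) us Bu).
  by apply: eq_bigr => b _; rewrite Bu linearZl_LR rmorph1 mulr1.
(* the eigenvalues of the inverse are at least 1 / (mu + lN) > 0 *)
have : (mu + lN)^-1%:C * dot v v <= \sum_(b <- s) dot (B (u b)) (u b).
  have -> : v = \sum_(b <- s) (1 : R[i]) *: u b.
    by rewrite vE; apply: eq_bigr => b _; rewrite scale1r.
  rewrite (dot_eigen_sum hB (fun=> 1) (fun=> 1) us Bu) mulr_sumr.
  apply: ler_sum => b _; rewrite rmorph1 !mul1r Bu linearZl_LR /=.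
  have [->|ub0] := eqVneq (u b) 0; first by rewrite !linear0r !mulr0.
  have [r -> /andP [lr _]] := resolvent_eigen ub0 (Bu b).
  by rewrite ler_wpM2r // lecR.
apply: lt_le_trans; rewrite mulr_gt0 ?neq0_dnorm_gt0 // ltcR invr_gt0.
rewrite (lt_le_trans mul1_gt0) // lerD2l -lecR; exact: minA.2 _ maxA.1.
Qed.

End Resolvent.

(* complex.sqrtc has nonnegative real part, as opposed to sqrtC: it is the root
   with argument in ]-pi/2, pi/2[ for every argument off ]-oo, 0]. *)
Theorem theorem3p5 (R : realType) :
  exists c : R[i] -> R -> R -> R,
  forall (V : vectType R[i]) (dot : {dot V for Num.conj}) (A : 'End(V))
    (l1 lN : R) (z : R[i]) (mu : R),
  hermitian_op dot A -> posdef_op dot A ->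
  smallest_eigenvalue A l1 -> largest_eigenvalue A lN -> l1 < lN ->
  - pi < carg z < pi ->
  - l1 < mu -> z != mu%:C ->
  let zt : R[i] := (z - mu%:C)^-1 in
  let B : 'End(V) := ((mu%:C *: \1 + A)^-1)%VF in
  let phi : R := carg zt in
  - pi < phi < pi ->
  let lt1 : R := (mu + lN)^-1 in
  let ltN : R := (mu + l1)^-1 in
  let st : R[i] := - ((lt1%:C + ltN%:C + 2%:R * zt) / (ltN%:C - lt1%:C)) in
  let sqN : R[i] := sqrtc (ltN%:C + zt) in
  let sq1 : R[i] := sqrtc (lt1%:C + zt) in
  let eta : R[i] := - ((sqN - sq1) / (sqN + sq1)) in
  (forall (n : nat) (g w0 w : V),
     zt *: w + B w = zt *: B g ->
     let e (k : nat) : V := cg_iterate dot B zt g w0 k - w in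
     tnorm dot B zt (e n) <=
       ((cos (phi / 2%:R))^-1)%:C * `|(tchebyshev R n).[st]|^-1
         * tnorm dot B zt (e 0%N))
  /\ (forall n : nat, (tchebyshev R n).[st] = (eta ^+ n + eta ^- n) / 2%:R)
  /\ `|eta| <= (c z l1 mu)%:C
  /\ c z l1 mu < 1.
Proof.
(* the square root of (M - 2 P) / (M + 2 P), for the upper bound M = 2 (ltN + n)
   of S = |a|^2 + |b|^2 and the lower bound (n + x) / 2 of P *)
exists (fun z l1 mu => let zt := (z - mu%:C)^-1 in
  let n := Normc.normc zt in let x := complex.Re zt in
  Num.sqrt ((2 * (mu + l1)^-1 + n - x) / (2 * (mu + l1)^-1 + 3 * n + x))).
move=> V dot A l1 lN z mu hA _ minA maxA l1N _ mul1 zmu zt B phi cz.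
move=> lt1 ltN st sqN sq1 eta.
have mul1_gt0 : 0 < mu + l1 by lra.
have zt0 : zt != 0 by rewrite invr_eq0 subr_eq0.
have nx : 0 < Normc.normc zt + complex.Re zt by exact: slit_normc_gt.
have n0 : 0 < Normc.normc zt by exact: normc_gt0.
have lt1_gt0 : 0 < lt1 by rewrite invr_gt0; lra.
have lt1N : lt1 < ltN by rewrite ltf_pV2 ?posrE ?ltrD2l //; lra.
have ltN_gt0 : 0 < ltN by rewrite invr_gt0.
have sqNE : sqN ^+ 2 = ltN%:C + zt by exact: sqr_sqrtc.
have sq1E : sq1 ^+ 2 = lt1%:C + zt by exact: sqr_sqrtc.
have dC : ltN%:C - lt1%:C != 0 :> R[i].
  by rewrite -rmorphB /= (inj_eq (@complexI R) _ 0) subr_eq0 gt_eqF.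
have dE : (sqN - sq1) * (sqN + sq1) = ltN%:C - lt1%:C.
  by rewrite -subr_sqr sqNE sq1E; ring.
have [dm dp] : sqN - sq1 != 0 /\ sqN + sq1 != 0.
  by apply/andP; rewrite -negb_or -mulf_eq0 dE.
have eta0 : eta != 0 by rewrite oppr_eq0 mulf_neq0 ?invr_neq0.
have stE : (eta + eta^-1) / 2%:R = st.
  rewrite /st -dE.
  have -> : lt1%:C + ltN%:C + 2%:R * zt = sqN ^+ 2 + sq1 ^+ 2.
    by rewrite sqNE sq1E; ring.
  by rewrite /eta; field; rewrite dm dp.
have c_lt1 : Num.sqrt ((2 * ltN + Normc.normc zt - complex.Re zt) /
    (2 * ltN + 3 * Normc.normc zt + complex.Re zt)) < 1.
  rewrite -[ltRHS]sqrtr1 ltr_sqrt // ltr_pdivrMr; lra.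
have eta_le : Normc.normc eta <= Num.sqrt
    ((2 * ltN + Normc.normc zt - complex.Re zt) /
     (2 * ltN + 3 * Normc.normc zt + complex.Re zt)).
  rewrite /eta normcN; apply: normc_sqrtc_ratio => //; exact: ltW.
have hB : hermitian_op dot B := resolvent_hermitian hA mul1_gt0 minA maxA.
have pB : posdef_op dot B := resolvent_posdef hA mul1_gt0 minA maxA.
split; last first.
  split; first by move=> n; rewrite -stE tchebyshev_eval.
  by split=> //; rewrite normc_normE lecR.
move=> n g w0 w wE; cbv beta zeta; rewrite (cg_iterate0 pB g w0 cz).
set T := (tchebyshev R n).[st].
have T0 : T != 0.
  rewrite /T -stE tchebyshev_neq0 // normc_normE ltcR.
  exact: le_lt_trans eta_le c_lt1.
(* the affine map sending the interval between lt1 and ltN onto [-1, 1] *)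
pose s := to_unit_itv lt1 ltN; have sE := horner_to_unit_itv lt1 ltN.
have sq : (size (T^-1 *: (tchebyshev R n \Po s))%R <= n.+1)%N.
  rewrite (leq_trans (size_scale_leq _ _)) //.
  rewrite (leq_trans (size_comp_poly_leq _ _)) // ltnS.
  have [-> _] := tchebyshevP R n; rewrite -[leqRHS]muln1 leq_mul2l.
  by apply/orP; right; rewrite -ltnS; case: (size s) (size_to_unit_itv lt1 ltN).
apply: (cg_error_poly hB pB _ cz wE sq).
- rewrite hornerZ horner_comp sE.
  have -> : (2%:R * - zt - (lt1%:C + ltN%:C)) / (ltN%:C - lt1%:C) = st.
    by rewrite /st; field.
  by rewrite -/T mulVf.
- by rewrite invr_ge0.
move=> b u u0 Bu.
have [r -> /andP [lo hi]] := resolvent_eigen mul1_gt0 minA maxA u0 Bu.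
rewrite hornerZ horner_comp normrM normfV -[leRHS]mulr1 ler_wpM2l ?invr_ge0 //.
have -> : s.[r%:C] = ((2 * r - (lt1 + ltN)) / (ltN - lt1))%:C.
  exact: horner_to_unit_itv_real.
apply: tchebyshev_le1; rewrite ler_pdivlMr ?ler_pdivrMr ?subr_gt0 //.
rewrite -/lt1 -/ltN in lo hi; apply/andP; split; lra.
Qed.
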